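(* Let $G_0$ be a maximal directed ancestral graph (the causal graph) with finite node set $V$ and let $P$ be a joint probability distribution of random variables $(X_v)_{v\in V}$. Suppose that $P$ is Markovian to $G_0$, that $P$ is converse pairwise Markovian to $G_0$, and that $P$ satisfies ordered upward-stability and ordered downward-stability w.r.t. $G_0$. Let $G(P)$ be an output of a natural structure-learning algorithm. (a) If $P$ is also path-stable, then $G(P)$ is Markov equivalent to $G_0$. (b) If $G_0$ is a DAG and $P$ is V-stable, then $G(P)$, if it is a DAG, is Markov equivalent to $G_0$.
   Context: Graphs. A directed ancestral graph on a finite node set $V$ is a simple graph (at most one edge between two distinct nodes) whose edges are arrows $i\to j$ or arcs $i\leftrightarrow j$, with no directed cycle and with no arc one of whose endpoints is an ancestor of the other. A DAG is such a graph with arrows only. Write $i\sim j$ if $i,j$ are adjacent. $\mathrm{an}(i)$ is the set of nodes $k\neq i$ with a directed path from $k$ to $i$; $\mathrm{an}(i,j)=(\mathrm{an}(i)\cup\mathrm{an}(j))\setminus\{i,j\}$. A path has no repeated nodes; an inner node of a path is a collider on it if both adjacent path edges have an arrowhead at it, else a non-collider. A path is connecting given $C$ if every collider on it is in $C$ or is an ancestor of a node of $C$ and no non-collider inner node is in $C$. For disjoint $A,B,C$ write $A\perp B\mid C$ (separation) if no path between $A$ and $B$ is connecting given $C$. $\mathcal J(G)$ is the set of triples $\langle A,B\mid C\rangle$ with $A\perp B\mid C$ in $G$. $G,H$ are Markov equivalent if $\mathcal J(G)=\mathcal J(H)$. $G$ is maximal if for every non-adjacent pair $i,j$ there is $C$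 with $i\perp j\mid C$. The skeleton $\mathrm{sk}(G)$ is the undirected graph obtained by removing all arrowheads. Distributions. $A\perp\!\!\!\perp B\mid C$ means $X_A$ is conditionally independent of $X_B$ given $X_C$ under $P$. $P$ is Markovian to $G$ if $A\perp B\mid C$ in $G$ implies $A\perp\!\!\!\perp B\mid C$ for all disjoint $A,B,C$. $P$ is converse pairwise Markovian to $G_0$ if for all distinct $i,j$: $i\perp\!\!\!\perp j\mid \mathrm{an}(i,j)$ implies $i\not\sim j$ in $G_0$ (ancestors taken in $G_0$). $\mathrm{sk}(P)$ is the undirected graph on $V$ in which distinct $i,j$ are adjacent iff there is no $C\subseteq V\setminus\{i,j\}$ with $i\perp\!\!\!\perp j\mid C$. Ordered stability. The minimal order of $G$ is the partial order in which $k>i$ iff $k\in\mathrm{an}(i)$. $P$ satisfies, w.r.t. $G$ (i.e. w.r.t. its minimal order): ordered upward-stability if $i\perp\!\!\!\perp j\mid C$ implies $i\perp\!\!\!\perp j\mid C\cup\{k\}$ for every $k\in V\setminus\{i,j\}$ with $i<k$ or $j<k$; ordered downward-stability if $i\perp\!\!\!\perp j\mid C$ implies $i\perp\!\!\!\perp j\mid C\setminus\{k\}$ for every $k\in V\setminus\{i,j\}$ with $i\nless k$, $j\nless k$, and $l\nless k$ for every $l\in C\setminus\{k\}$. Natural algorithm. A graph $G(P)$ on $V$ is an output of a natural structure-learning algorithm if it is a maximal directed ancestral graph with $\mathrm{sk}(G(P))=\mathrm{sk}(P)$ and $P$ satisfies ordered upward- and downward-stability w.r.t. $G(P)$. Path-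 and V-stability. $P$ is path-unstable if there is a path $\langle i=i_0,i_1,\dots,i_r,k,j\rangle$ ($r\ge 0$) in $\mathrm{sk}(P)$ with $i\not\sim j$ and $i_n\sim j$ for every $1\le n\le r$, and a set $C$ disjoint from $\{i,j,k\}$, such that $i\perp\!\!\!\perp j\mid U\cup C$ and $i\perp\!\!\!\perp j\mid U\cup C\cup\{k\}$, where $U=\{i_1,\dots,i_r\}$ ($U=\emptyset$ if $r=0$). $P$ is path-stable if it is not path-unstable. $P$ is V-unstable if there are $i,k,j$ with $i\sim k$, $k\sim j$, $i\not\sim j$ in $\mathrm{sk}(P)$ and a set $C$ disjoint from $\{i,j,k\}$ with $i\perp\!\!\!\perp j\mid C$ and $i\perp\!\!\!\perp j\mid C\cup\{k\}$; it is V-stable otherwise. *)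

(* Defs.v *)
From HB Require Import structures.
From mathcomp Require Import all_boot all_order all_algebra.
From mathcomp Require Import all_classical all_reals all_analysis.

Set Implicit Arguments.
Unset Strict Implicit.
Unset Printing Implicit Defensive.

(* [arrow G i j] is i -> j and [bidir G i j] is i <-> j. *)
Record mixed_graph (V : finType) := MixedGraph {
  arrow : rel V;
  bidir : rel V
}.

Section Graphs.
Variable V : finType.
Implicit Types (G H : mixed_graph V) (i j k x y : V) (A B C : {set V}).

Definition adj G : rel V :=
  fun i j => [|| arrow G i j, arrow G j i | bidir G i j].

Definition arrowhead_at G : rel V := fun i j => arrow G i j || bidir G i j.

(* Arcs are unordered, whence the symmetry. *)
Definition simple_mixed G : Prop :=
  [/\ irreflexive (arrow G), irreflexive (bidir G), symmetric (bidir G),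
      forall i j, arrow G i j -> ~~ arrow G j i &
      forall i j, arrow G i j -> ~~ bidir G i j].

(* [connect] speaks of directed walks; removing loops from a walk gives a
   path with the same endpoints. *)
Definition an G i : {set V} := [set k | (k != i) && connect (arrow G) k i].

Definition an2 G i j : {set V} := (an G i :|: an G j) :\: [set i; j].

Definition directed_ancestral G : Prop :=
  [/\ simple_mixed G,
      forall c : seq V, ucycle (arrow G) c -> c = [::] &
      forall i j, bidir G i j -> i \notin an G j /\ j \notin an G i].

Definition is_dag G : Prop :=
  directed_ancestral G /\ forall i j, ~~ bidir G i j.

(* A path is given by its nonempty sequence of nodes x :: p, which determines
   its edges because the graph is simple. *)
Definition graph_path G x (p : seq V) : Prop :=
  path (adj G) x p /\ uniq (x :: p).

Definition collider G a k b : bool := arrowhead_at G a k && arrowhead_at G b k.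

Definition connecting G C (s : seq V) : Prop :=
  forall s1 a k b s2, s = s1 ++ [:: a, k, b & s2] ->
    if collider G a k b then (k \in C) || [exists c in C, k \in an G c]
    else k \notin C.

Definition separated G A B C : Prop :=
  forall x p, graph_path G x p -> x \in A -> last x p \in B ->
    ~ connecting G C (x :: p).

Definition disjoint3 A B C : bool :=
  [&& [disjoint A & B], [disjoint A & C] & [disjoint B & C]].

Definition indep_model G : set ({set V} * {set V} * {set V}) :=
  fun t => let: (A, B, C) := t in disjoint3 A B C /\ separated G A B C.

Definition markov_equivalent G H : Prop := indep_model G = indep_model H.

Definition maximal_graph G : Prop :=
  forall i j, i != j -> ~~ adj G i j ->
    exists C, C \subset ~: [set i; j] /\ separated G [set i] [set j] C.

(* The minimal order of G: i < k iff k is an ancestor of i. *)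
Definition minimal_lt G : rel V := fun i k => k \in an G i.

End Graphs.

(* The following conditions on P depend only on its ternary relation
   I A B C of conditional independence of X_A and X_B given X_C. *)
Section Stability.
Variables (V : finType) (I : {set V} -> {set V} -> {set V} -> Prop).
Implicit Types (G : mixed_graph V) (lt : rel V) (i j k : V) (A B C : {set V}).

Definition markovian G : Prop :=
  forall A B C, disjoint3 A B C -> separated G A B C -> I A B C.

Definition converse_pairwise_markovian G : Prop :=
  forall i j, i != j -> I [set i] [set j] (an2 G i j) -> ~~ adj G i j.

Definition sk : rel V := fun i j =>
  (i != j) &&
  `[< ~ exists C, C \subset ~: [set i; j] /\ I [set i] [set j] C >].

Definition ordered_upward_stable lt : Prop :=
  forall i j C, i != j -> C \subset ~: [set i; j] -> I [set i] [set j] C ->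
    forall k, k \notin [set i; j] -> lt i k || lt j k ->
      I [set i] [set j] (k |: C).

Definition ordered_downward_stable lt : Prop :=
  forall i j C, i != j -> C \subset ~: [set i; j] -> I [set i] [set j] C ->
    forall k, k \notin [set i; j] -> ~~ lt i k -> ~~ lt j k ->
      (forall l, l \in C :\ k -> ~~ lt l k) ->
      I [set i] [set j] (C :\ k).

Definition natural_output G : Prop :=
  [/\ directed_ancestral G, maximal_graph G, adj G =2 sk,
      ordered_upward_stable (minimal_lt G) &
      ordered_downward_stable (minimal_lt G)].

(* p is the (possibly empty) sequence i_1, ..., i_r. *)
Definition path_unstable : Prop :=
  exists i (p : seq V) k j C,
    [/\ path sk i (p ++ [:: k; j]) /\ uniq (i :: p ++ [:: k; j]),
        ~~ sk i j, forall x, x \in p -> sk x j,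
        [disjoint C & [set i; j; k]] &
        I [set i] [set j] ([set x in p] :|: C) /\
        I [set i] [set j] ([set x in p] :|: C :|: [set k])].

Definition path_stable : Prop := ~ path_unstable.

(* The nodes i, k, j are distinct: sk is irreflexive, and i != j is explicit. *)
Definition V_unstable : Prop :=
  exists i k j C,
    [/\ i != j, [/\ sk i k, sk k j & ~~ sk i j],
        [disjoint C & [set i; j; k]],
        I [set i] [set j] C & I [set i] [set j] (C :|: [set k])].

Definition V_stable : Prop := ~ V_unstable.

End Stability.

Section ConditionalIndependence.
Local Open Scope classical_set_scope.
Local Open Scope ereal_scope.
Context (d : measure_display) (T : measurableType d) (R : realType).
Variable P : probability T R.

(* f is a version of the conditional probability P(E | F), for a
   sub-sigma-algebra F of the measurable sets of T. *)
Definition cond_prob_version (F : set (set T)) (E : set T) (f : T -> R) : Prop :=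
  [/\ forall S : set R, measurable S -> F (f @^-1` S),
      P.-integrable setT (EFin \o f) &
      forall B, F B -> \int[P]_(w in B) (f w)%:E = P (E `&` B)].

Variables (V : finType) (dE : V -> measure_display).
Variables (E : forall v, measurableType (dE v)) (X : forall v, T -> E v).

(* The sigma-algebra generated by X_A = (X_v)_{v in A}. *)
Definition sigma_of (A : {set V}) : set (set T) :=
  <<s \bigcup_(v in [set` A]) preimage_set_system setT (X v) measurable >>.

(* P(E1 /\ E2 | X_C) = P(E1 | X_C) P(E2 | X_C) almost surely, for all events
   E1 of X_A and E2 of X_B. *)
Definition cond_indep (A B C : {set V}) : Prop :=
  forall E1 E2, sigma_of A E1 -> sigma_of B E2 ->
    exists f1 f2 f12 : T -> R,
      [/\ cond_prob_version (sigma_of C) E1 f1,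
          cond_prob_version (sigma_of C) E2 f2,
          cond_prob_version (sigma_of C) (E1 `&` E2) f12 &
          {ae P, forall w, f12 w = (f1 w * f2 w)%R}].

End ConditionalIndependence.

(* Main.v *)
(* Both graphs have skeleton sk(P), and for a non-adjacent pair i, j ordered
   stability moves between any separating set and an(i,j). If k ends a
   discriminating path for i, j (or an unshielded triple) in both graphs and is
   a collider in G but not in H, then stability with respect to H puts k into
   the conditioning set and stability with respect to G removes it at a moment
   when only k changes: this is path-instability (V-instability for triples).

   Markov equivalence is then proved by transporting connecting walks, where
   colliders are ancestors of C and non-colliders are outside C. On a shortest
   walk of G between two nodes every triple is unshielded or discriminated by
   the part of the walk on its left or on its right. Two triples cannot
   discriminate each other, for this would give an inducing path in a maximal
   graph; hence no triple changes its status in H. If moreover the sum of the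
   distances of the nodes to C is minimal, then the first arrow b -> d of a
   shortest directed path from a collider b to C is also discriminated by a
   part of the walk, so that b remains an ancestor of C in H. *)

Require Import Defs.
From HB Require Import structures.
From mathcomp Require Import all_boot all_order all_algebra.
From mathcomp Require Import all_classical all_reals all_analysis.
From mathcomp Require Import zify.

Set Implicit Arguments.
Unset Strict Implicit.
Unset Printing Implicit Defensive.

Local Open Scope nat_scope.

Ltac nat_lia :=
  repeat match goal with H : ?T |- _ =>
    lazymatch T with
    | nat => fail
    | is_true (leq _ _) => fail
    | is_true (_ && _) => fail
    | is_true (~~ (@eq_op _ _ _)) => fail
    | @eq nat _ _ => fail
    | _ => clear H
    end
  end; lia.

Lemma ex_min (P : nat -> Prop) :
  (exists n, P n) -> exists n, P n /\ forall m, P m -> n <= m.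
Proof.
move=> exP; have exQ : exists n, `[< P n >] by case: exP => n ?; exists n; apply/asboolP.
case: (ex_minnP exQ) => n /asboolP Pn nmin; exists n; split=> // m Pm.
by apply: nmin; apply/asboolP.
Qed.

(** * Walks in directed ancestral graphs *)

Section Graph.
Variables (V : finType) (G : mixed_graph V).
Implicit Types (a b c k x y : V) (A B C D : {set V}) (u v w : nat -> V).

Definition anc_of D k : bool := [exists c in D, connect (arrow G) k c].

(** Non-colliders are tested against C and colliders against D. The sets differ only while D is
    enlarged by end nodes; C = D is the usual notion of connection. *)
Definition open_at C D a k b : bool :=
  if collider G a k b then anc_of D k else k \notin C.

Definition walk C D v n : Prop :=
  (forall i, i < n -> adj G (v i) (v i.+1)) /\
  (forall i, i.+1 < n -> open_at C D (v i) (v i.+1) (v i.+2)).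

Definition linked C D x y : Prop :=
  exists n v, [/\ walk C D v n, v 0 = x & v n = y].

Definition vcons x v i := if i is j.+1 then v j else x.
Definition vcat v n w i := if i <= n then v i else w (i - n.+1).
Definition vrev v n i : V := v (n - i).

Lemma colliderC a k b : collider G a k b = collider G b k a.
Proof. by rewrite /collider andbC. Qed.

Lemma open_atC C D a k b : open_at C D a k b = open_at C D b k a.
Proof. by rewrite /open_at colliderC. Qed.

Lemma anc_ofE D k : (k \in D) || [exists c in D, k \in an G c] = anc_of D k.
Proof.
apply/idP/existsP => [/orP[kD|/existsP[c /andP[cD]]]|[c /andP[cD kc]]].
- by exists k; rewrite kD connect0.
- by rewrite inE => /andP[_ kc]; exists c; rewrite cD.
- have [<-|neq] := eqVneq c k; first by rewrite cD.
  by apply/orP; right; apply/existsP; exists c; rewrite cD inE eq_sym neq.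
Qed.

Lemma anc_of_mem D k : k \in D -> anc_of D k.
Proof. by move=> kD; rewrite -anc_ofE kD. Qed.

Lemma anc_of_connect D a b : connect (arrow G) a b -> anc_of D b -> anc_of D a.
Proof.
move=> ab /existsP[c /andP[cD bc]]; apply/existsP; exists c.
by rewrite cD (connect_trans ab).
Qed.

Lemma anc_of_arrow D a b : arrow G a b -> anc_of D b -> anc_of D a.
Proof. by move=> /connect1; apply: anc_of_connect. Qed.

Lemma walk_cons C D x v n : walk C D v n -> adj G x (v 0) ->
  (0 < n -> open_at C D x (v 0) (v 1)) -> walk C D (vcons x v) n.+1.
Proof. by move=> [av ov] ax ox; split=> -[|i] //=; [apply: av|apply: ov]. Qed.

Lemma walk_prefix C D v n m : m <= n -> walk C D v n -> walk C D v m.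
Proof. by move=> mn [av ov]; split=> i im; [apply: av|apply: ov]; nat_lia. Qed.

Lemma walk_suffix C D v n m : m <= n -> walk C D v n ->
  walk C D (fun i => v (m + i)) (n - m).
Proof.
move=> mn [av ov]; split=> i im; rewrite !addnS; [apply: av|apply: ov]; nat_lia.
Qed.

Lemma walk_cat C D v n w m : walk C D v n -> walk C D w m -> adj G (v n) (w 0) ->
  (0 < n -> open_at C D (v n.-1) (v n) (w 0)) ->
  (0 < m -> open_at C D (v n) (w 0) (w 1)) ->
  walk C D (vcat v n w) (n + m.+1).
Proof.
move=> [av ov] [aw ow] avw ovw ovw'; split=> i im; rewrite /vcat.
- have [lt_in|lt_ni|->] := ltngtP i n.
  + exact: av.
  + have -> : i.+1 - n.+1 = (i - n.+1).+1 by nat_lia.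
    by apply: aw; nat_lia.
  + by rewrite subnn.
- have [lt_in|lt_ni|eq_in] := ltngtP i n.
  + have [lt_in1|lt_ni1|eq_in1] := ltngtP i.+1 n; last 1 first.
    * by rewrite eq_in1 subnn; subst n; apply: ovw.
    * exact: ov.
    * nat_lia.
  + have -> : (i.+2 <= n) = false by nat_lia.
    have -> : i.+1 - n.+1 = (i - n.+1).+1 by nat_lia.
    have -> : i.+2 - n.+1 = (i - n.+1).+2 by nat_lia.
    by apply: ow; nat_lia.
  + have -> : (i.+2 <= n) = false by nat_lia.
    have -> : i.+2 - n.+1 = 1 by nat_lia.
    by rewrite eq_in subnn; apply: ovw'; nat_lia.
Qed.

(** * Arrowheads and ancestors *)

Section Ancestral.
Hypothesis hG : directed_ancestral G.

Notation ah := (arrowhead_at G).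

(** For an arrow this is acyclicity, for an arc the ancestral condition. *)
Lemma arrowhead_nanc a b : ah a b -> ~~ connect (arrow G) b a.
Proof.
case: hG => [[irr irb _ _ _] acyc anb] /orP[ab|ab]; apply/negP => cba.
- case/connectP: cba => p /shortenP[q qp uq _ ->] in ab *.
  suff /acyc : ucycle (arrow G) (b :: q) by [].
  by apply/andP; split=> //=; rewrite rcons_path qp.
- case: (anb _ _ ab) => _; rewrite inE cba andbT negbK => /eqP eab.
  by move: ab; rewrite eab irb.
Qed.

Lemma arrowhead_irr a : ah a a = false.
Proof. by apply/negP => /arrowhead_nanc; rewrite connect0. Qed.

Lemma adjE a b : adj G a b = ah a b || ah b a.
Proof.
case: hG => [[_ _ sb _ _] _ _]; rewrite /adj /arrowhead_at (sb b a).
by case: (arrow G a b); case: (arrow G b a); case: (bidir G a b).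
Qed.

Lemma arrowE a b : arrow G a b = ah a b && ~~ ah b a.
Proof.
case: hG => [[_ _ sb asym nab] _ _]; rewrite /arrowhead_at (sb b a).
have := asym a b; have := nab a b.
by case: (arrow G a b); case: (arrow G b a); case: (bidir G a b) => //= H1 H2;
  rewrite ?(H1 isT) ?(H2 isT) //; move: (H1 isT) (H2 isT).
Qed.

Lemma adj_sym a b : adj G a b = adj G b a.
Proof. by rewrite !adjE orbC. Qed.

Lemma adj_irr a : adj G a a = false.
Proof. by rewrite adjE arrowhead_irr. Qed.

Lemma arrow_adj a b : adj G a b -> ~~ ah b a -> arrow G a b.
Proof. by rewrite adjE arrowE => /orP[] -> // ->. Qed.

Lemma arrow_arrowhead a b : arrow G a b -> ah a b.
Proof. by rewrite arrowE => /andP[]. Qed.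

Lemma arrow_narrowhead a b : arrow G a b -> ah b a = false.
Proof. by rewrite arrowE => /andP[_ /negbTE]. Qed.

Lemma arrowhead_arrow a b c : ah a b -> arrow G b c -> adj G a c -> ah a c.
Proof.
move=> ab bc ac; apply/negPn/negP => nac; have ca : arrow G c a.
  by apply: arrow_adj; rewrite // adj_sym.
by have /negP := arrowhead_nanc ab; apply; apply: (connect_trans (connect1 bc)); apply: connect1.
Qed.

Lemma arrow2_narrowhead a b c : arrow G a b -> arrow G b c -> ah c a = false.
Proof.
move=> ab bc; apply/negP => /arrowhead_nanc/negP; apply.
exact: (connect_trans (connect1 ab) (connect1 bc)).
Qed.

Lemma walk_rev C D v n : walk C D v n -> walk C D (vrev v n) n.
Proof.
rewrite /vrev => -[av ov]; split=> i im.
- rewrite adj_sym; have -> : n - i = (n - i.+1).+1 by nat_lia.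
  by apply: av; nat_lia.
- rewrite open_atC; have -> : n - i = (n - i.+2).+2 by nat_lia.
  have -> : n - i.+1 = (n - i.+2).+1 by nat_lia.
  by apply: ov; nat_lia.
Qed.

Lemma linkedC C D x y : linked C D x y -> linked C D y x.
Proof.
move=> [n [v [wv vx vy]]]; exists n, (vrev v n); split; first exact: walk_rev.
  by rewrite /vrev subn0.
by rewrite /vrev subnn.
Qed.

(** * Rerouting walks along directed paths *)

(** Put x' in front of the walk: its edge has no arrowhead at x, so x becomes a non-collider, and it
    lies outside C. *)
Lemma linked_arrow C D x x' y : x \notin C -> arrow G x x' ->
  linked C D x y -> linked C D x' y.
Proof.
move=> xC xx' [n [v [wv vx vy]]]; exists n.+1, (vcons x' v); split=> //.
apply: walk_cons => //; first by rewrite adjE vx (arrow_arrowhead xx') orbT.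
by move=> _; rewrite /open_at /collider vx (arrow_narrowhead xx').
Qed.

(** No descendant of x lies in D, hence none in C, and the directed path is put in front arrow by
    arrow. *)
Lemma linked_descend C D x x' y : C \subset D -> connect (arrow G) x x' ->
  ~~ anc_of D x -> linked C D x y -> linked C D x' y.
Proof.
move=> CD /connectP[p + ->]; elim: p x => //= z p IH x /andP[xz zp] nx lxy.
apply: IH => //; first by apply: contra nx; apply: anc_of_arrow.
apply: (linked_arrow _ xz lxy); apply: contra nx => xC.
exact: (anc_of_mem (fintype.subsetP CD _ xC)).
Qed.

(* A collider that is an ancestor of x but not of D is bypassed by a directed
   path from it to x. *)
Lemma linked_drop_end C D x y : C \subset D ->
  linked C (x |: D) x y -> linked C D x y.
Proof.
move=> CD [n [v [wv vx vy]]].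
(* The start of the walk varies in the induction while x is fixed: from the collider nearest to y
   that is no ancestor of D, a directed path to x replaces everything before it. *)
suff [|wv'] : linked C D x y \/ walk C D v n; [by []|by exists n, v|].
elim: n v wv vy {vx} => [|n IH] v wv vy; first by right.
have [] := IH (fun i => v i.+1) _ vy; first by have := walk_suffix (ltn0Sn n) wv; rewrite subn1.
  by left.
move=> wv'; case: n wv vy wv' {IH} => [|n] wv vy wv'.
  by right; split=> // -[|//] _; apply: (wv.1 0).
have := wv.2 0 isT.
have [op _|nop op] := boolP (open_at C D (v 0) (v 1) (v 2)).
  by right; split=> -[|i] //=; [move=> _; apply: (wv.1 0)|apply: (wv'.1 i)|apply: (wv'.2 i)].
left; move: op nop; rewrite /open_at; case: ifP => [_|_ ->] //.
case/existsP=> c /andP[/setU1P[->|cD] v1c] no; last first.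
  by case/negP: no; apply/existsP; exists c; rewrite cD.
by apply: (linked_descend CD v1c no); exists n.+1, (fun i => v i.+1).
Qed.

(** For a walk whose inner nodes are all colliders and ancestors of an end, this applies to every C:
    an inducing path cannot be blocked. *)
Lemma linked_inducing C x y :
  linked C (x |: (y |: C)) x y -> linked C C x y.
Proof.
move=> l; apply/linkedC/linked_drop_end => //; apply/linkedC/linked_drop_end => //.
exact: finset.subsetUr.
Qed.

(** * Surgery on walks and shortest walks *)

Lemma walk_splice C D v n l r : walk C D v n -> l <= n -> r <= n ->
  adj G (v l) (v r) ->
  (0 < l -> open_at C D (v l.-1) (v l) (v r)) ->
  (r < n -> open_at C D (v l) (v r) (v r.+1)) ->
  exists w, [/\ walk C D w (l + (n - r).+1), w 0 = v 0 & w (l + (n - r).+1) = v n].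
Proof.
move=> wv ln rn alr ol or; exists (vcat v l (fun i => v (r + i))); split.
- apply: walk_cat; rewrite ?addn0 ?addn1 //; first exact: walk_prefix wv.
    exact: walk_suffix.
  by move=> lt_rn; apply: or; nat_lia.
- by [].
- rewrite /vcat ifN; last by nat_lia.
  by congr v; nat_lia.
Qed.

Lemma walk_insert C D v n l r d : walk C D v n -> l <= n -> r <= n ->
  adj G (v l) d -> adj G d (v r) -> open_at C D (v l) d (v r) ->
  (0 < l -> open_at C D (v l.-1) (v l) d) ->
  (r < n -> open_at C D d (v r) (v r.+1)) ->
  exists w, [/\ walk C D w (l + (n - r).+2), w 0 = v 0,
    w (l + (n - r).+2) = v n &
    (r = l.+2 -> forall i, w i = if i == l.+1 then d else v i)].
Proof.
move=> wv ln rn ald adr od ol or.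
exists (vcat v l (vcons d (fun i => v (r + i)))); split.
- apply: walk_cat => //=; rewrite ?addn0 //; first exact: walk_prefix wv.
  apply: walk_cons; rewrite ?addn0 ?addn1 //; first exact: walk_suffix.
  by move=> lt_rn; apply: or; nat_lia.
- by [].
- rewrite /vcat ifN; last by nat_lia.
  have -> : l + (n - r).+2 - l.+1 = (n - r).+1 by nat_lia.
  by rewrite /=; congr v; nat_lia.
- move=> -> i; rewrite /vcat; case: ltngtP => [lt_il|lt_li|->].
  + by rewrite ifN //; nat_lia.
  + case: eqVneq => [->|ne]; first by rewrite subnn.
    have -> : i - l.+1 = (i - l.+2).+1 by nat_lia.
    by rewrite /=; congr v; nat_lia.
  + by rewrite ifN //; nat_lia.
Qed.

Definition minwalk C v n : Prop :=
  walk C C v n /\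
  forall m w, walk C C w m -> w 0 = v 0 -> w m = v n -> n <= m.

Lemma minwalk_rev C v n : minwalk C v n -> minwalk C (vrev v n) n.
Proof.
move=> [wv vmin]; split=> [|m w ww]; first exact: walk_rev.
rewrite /vrev subn0 subnn => w0 wm; apply: (vmin _ (vrev w m) (walk_rev ww)).
  by rewrite /vrev subn0.
by rewrite /vrev subnn.
Qed.

(** An arrow propagates: either the next node is a collider, hence an ancestor of D, or the next
    edge is again an arrow pointing forward. *)
Lemma walk_forward C D v n i : walk C D v n -> arrow G (v i) (v i.+1) ->
  forall m, i + m < n -> anc_of D (v i) \/
    connect (arrow G) (v i.+1) (v (i + m).+1) /\
    arrow G (v (i + m)) (v (i + m).+1).
Proof.
move=> wv ai; elim=> [|m IH] im; first by right; rewrite addn0.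
have /IH[an_i|[conn am]] : i + m < n by nat_lia.
  by left.
move: im; rewrite addnS => im.
have := wv.2 (i + m); rewrite /open_at /collider.
rewrite (arrow_arrowhead am) /= => /(_ im); case: ifP => [_ an_m|na _].
  left; apply: (anc_of_arrow ai); exact: anc_of_connect conn an_m.
right; have am' : arrow G (v (i + m).+1) (v (i + m).+2).
  by apply: arrow_adj; [apply: wv.1|rewrite na].
by split=> //; apply: (connect_trans conn); apply: connect1.
Qed.

Lemma minwalk_inj C v n i j : minwalk C v n -> i < j <= n -> v i <> v j.
Proof.
move=> [wv vmin] /andP[ij jn] eij; case: i => [|i] in ij eij *.
  have := vmin _ _ (walk_suffix jn wv); rewrite addn0 subnKC // => /(_ (esym eij) erefl).
  nat_lia.
have [eq_jn|ne_jn] := eqVneq j n.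
  have wi : walk C C v i.+1 by apply: walk_prefix wv; nat_lia.
  have := vmin _ _ wi erefl; rewrite eij eq_jn => /(_ erefl); nat_lia.
have lt_jn : j < n by nat_lia.
have := walk_splice (l := i) (r := j) wv; case.
- nat_lia.
- nat_lia.
- by rewrite -eij; apply: wv.1; nat_lia.
- case: i ij eij => // i ij eij _; rewrite -eij; apply: wv.2; nat_lia.
(* After cutting the loop, a non-collider was a non-collider at one of the two visits. A new
   collider was a collider at one of them, or the walk leaves the first visit by an arrow; then it
   meets a collider below, or it returns along a directed cycle, which is impossible. *)
- move=> _; have oi := wv.2 i (leq_trans ij jn).
  have : open_at C C (v j.-1) (v j) (v j.+1).
    have : j.-1.+2 <= n by nat_lia.
    by move/wv.2; rewrite prednK //; nat_lia.
  move: oi; rewrite -eij /open_at /collider.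
  case ahi: (ah (v i) (v i.+1)) => //=.
  case ahj: (ah (v j.+1) (v i.+1)) => //=; last by rewrite andbF.
  rewrite andbT; case: ifP => // ahi' _; case: ifP => // ahj' _.
  have ai : arrow G (v i.+1) (v i.+2).
    by apply: arrow_adj; [apply: wv.1; nat_lia|rewrite ahi'].
  have := walk_forward wv ai (m := j - i.+2); case; [nat_lia|by []|].
  have -> : (i.+1 + (j - i.+2)).+1 = j by nat_lia.
  case=> conn _; have := arrowhead_nanc (arrow_arrowhead ai).
  by rewrite eij conn.
- move=> w [ww w0 wn]; have := vmin _ _ ww w0 wn; nat_lia.
Qed.

Lemma linked_minwalk C x y : linked C C x y ->
  exists n v, [/\ minwalk C v n, v 0 = x & v n = y].
Proof.
move=> /ex_min[n [[v [wv vx vy]] nmin]]; exists n, v; split=> //; split=> // m w ww w0 wm.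
by apply: nmin; exists w; rewrite w0 wm vx vy.
Qed.

(** A shortest connecting walk repeats no node, so it is a path, and walks can stand in for
    paths. *)
Lemma separatedP A B C :
  Defs.separated G A B C <-> forall x y, x \in A -> y \in B -> ~ linked C C x y.
Proof.
split=> [sep x y xA yB /linked_minwalk[n [v [mv vx vy]]]|nl x p].
- have [av ov] := mv.1; pose p := mkseq (fun i => v i.+1) n.
  have sE : x :: p = mkseq v n.+1 by rewrite -vx /p /mkseq /= (iotaDl 1 0) -map_comp.
  have nth_s m : m <= n -> nth x (x :: p) m = v m by move=> mn; rewrite sE nth_mkseq.
  have last_p : last x p = y.
    by rewrite (last_nth x) size_mkseq nth_s.
  apply: (sep x p); rewrite ?last_p //.
  + split.
      apply/(pathP x) => i; rewrite size_mkseq => lt_in.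
      by rewrite nth_s ?(ltnW lt_in) // nth_mkseq //; apply: av.
    rewrite sE; apply/(uniqP x) => i j; rewrite !inE size_mkseq !ltnS => le_in le_jn.
    rewrite !nth_mkseq // => eij; apply/eqP/negPn/negP.
    rewrite neq_ltn => /orP[lt|lt];
      [apply: (minwalk_inj mv _ eij)|apply: (minwalk_inj mv _ (esym eij))].
      by rewrite lt.
    by rewrite lt.
  + move=> s1 a k b s2 eqs; have := congr1 size eqs.
    rewrite /= size_mkseq size_cat /= => sz.
    have := ov (size s1); rewrite -!nth_s; try nat_lia.
    have [lt1 lt2] : ((size s1).+1 < size s1) = false /\ ((size s1).+2 < size s1) = false.
      by nat_lia.
    rewrite eqs !nth_cat ltnn subnn lt1 lt2 /=.
    have -> : (size s1).+1 - size s1 = 1 by nat_lia.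
    have -> : (size s1).+2 - size s1 = 2 by nat_lia.
    by rewrite anc_ofE /open_at => /=; case: ifP => _; apply; nat_lia.
- move=> [/(pathP x) px _] xA lB cx; apply: (nl _ _ xA lB).
  exists (size p), (nth x (x :: p)); split=> //; last by rewrite -last_nth.
  split=> i ip; first exact: px.
  have := cx (take i (x :: p)) (nth x (x :: p) i) (nth x (x :: p) i.+1)
    (nth x (x :: p) i.+2) (drop i.+3 (x :: p)).
  rewrite anc_ofE -!drop_nth ?cat_take_drop /=; try nat_lia.
  exact.
Qed.

(** * Discriminated triples on shortest walks *)

(* With k := v t.+1, the sequence v l, ..., v t, k, d is a discriminating path
   for k when l < t; when l = t, the triple v t, k, d is unshielded. *)
Definition discriminated v l t d : Prop :=
  [/\ l <= t, ~~ adj G (v l) d &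
    forall m, l <= m < t ->
      arrow G (v m.+1) d /\ collider G (v m) (v m.+1) (v m.+2)].

(** Search leftwards from [v t] for a node that can be joined to d. A node adjacent to d but not
    open towards d is in C; it is a collider of the walk but not towards d, so it points to d and
    prolongs the discriminating path. *)
Lemma discriminated_or_shortcut C v n t d : walk C C v n -> t < n ->
  (adj G (v t) d -> ah (v t) d) ->
  (0 < t -> ah (v t.-1) (v t) -> ah d (v t) -> anc_of C (v t)) ->
  (exists l, discriminated v l t d) \/
  exists l, [/\ l <= t, ah (v l) d & 0 < l -> open_at C C (v l.-1) (v l) d].
Proof.
move=> wv; elim: t => [|t IH] tn ahd hcol.
  have [ad|nad] := boolP (adj G (v 0) d); last by left; exists 0; split=> // m; nat_lia.
  by right; exists 0; split=> //; apply: ahd.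
have [ad|nad] := boolP (adj G (v t.+1) d); last first.
  by left; exists t.+1; split=> // m; nat_lia.
have [op|nop] := boolP (open_at C C (v t) (v t.+1) d).
  by right; exists t.+1; split=> //; apply: ahd.
have [ahtd ncol vC] : [/\ ah (v t.+1) d, ~~ collider G (v t) (v t.+1) d & v t.+1 \in C].
  move: nop; rewrite /open_at; case: ifP => [/andP[h1 h2]|_]; last first.
    by rewrite negbK; split=> //; apply: ahd.
  by rewrite hcol.
have /= col : collider G (v t) (v t.+1) (v t.+2).
  by have := wv.2 t tn; rewrite /open_at; case: ifP => //; rewrite vC.
have /andP[aht aht'] := col.
have arr : arrow G (v t.+1) d.
  by apply: arrow_adj => //; apply: contra ncol => ?; apply/andP.
have [] := IH (ltnW tn).
- exact: arrowhead_arrow aht arr.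
- move=> t0 h1 h2; have := wv.2 t.-1; rewrite prednK // /open_at => /(_ (ltnW tn)).
  suff -> : collider G (v t.-1) (v t) (v t.+1) by [].
  rewrite /collider h1; apply: contraTT h2 => h3; rewrite (arrow2_narrowhead _ arr) //.
  by rewrite arrowE aht.
- case=> l [lt nad dis]; left; exists l; split=> //; first exact: leqW.
  move=> m /andP[lm]; rewrite ltnS leq_eqVlt => /orP[/eqP->|mt] //.
  by apply: dis; rewrite lm.
- by case=> l [lt ahl op]; right; exists l; split=> //; exact: leqW.
Qed.

(** A shortcut would contradict minimality: like the old edge it has an arrowhead at [v i.+2], so
    the next triple keeps its status. *)
Lemma minwalk_discriminated C v n i : minwalk C v n -> i.+1 < n ->
  ah (v i) (v i.+2) -> ah (v i.+1) (v i.+2) ->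
  (0 < i -> ah (v i.-1) (v i) -> ah (v i.+2) (v i) -> anc_of C (v i)) ->
  exists l, discriminated v l i (v i.+2).
Proof.
move=> [wv vmin] lin ac bc hcol.
have [||//|[l [li lc op]]] := discriminated_or_shortcut wv _ _ hcol; [nat_lia|by []|].
have [] := walk_splice wv (l := l) (r := i.+2) => //; try nat_lia.
- by rewrite adjE lc.
- move=> lt_in; have := wv.2 i.+1 lt_in; rewrite /open_at /collider lc bc; exact.
- by move=> w [ww w0 wn]; have := vmin _ _ ww w0 wn; nat_lia.
Qed.

Lemma minwalk_arrow_discriminated C v n i : minwalk C v n -> i.+1 < n ->
  arrow G (v i.+1) (v i.+2) -> ah (v i) (v i.+2) ->
  exists l, discriminated v l i (v i.+2).
Proof.
move=> mv lin bc ac; have [wv _] := mv.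
apply: (minwalk_discriminated mv) => //; first exact: arrow_arrowhead.
move=> i0 pa ca; have := wv.2 i.-1; rewrite prednK // /open_at => /(_ (ltnW lin)).
suff -> : collider G (v i.-1) (v i) (v i.+1) by [].
rewrite /collider pa; apply: contraTT ca => h3; rewrite (arrow2_narrowhead _ bc) //.
by apply: arrow_adj => //; apply: wv.1; apply: ltnW.
Qed.

Lemma minwalk_collider_discriminated C v n i : minwalk C v n -> i.+1 < n ->
  collider G (v i) (v i.+1) (v i.+2) -> arrow G (v i) (v i.+2) ->
  exists l, discriminated v l i (v i.+2).
Proof.
move=> mv lin col ac; have [wv vmin] := mv; have /andP[ab cb] := col.
have ca := arrow_narrowhead ac.
have [bc|nbc] := boolP (ah (v i.+1) (v i.+2)).
  apply: (minwalk_discriminated mv) => //; first exact: arrow_arrowhead.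
  by rewrite ca.
(* In this case the walk could take [v i -> v i.+2] directly: [v i] stays a non-collider, and
   [v i.+2] is an ancestor of C through [v i.+1]. *)
have arr : arrow G (v i.+2) (v i.+1) by rewrite arrowE cb.
have ba : ah (v i.+1) (v i) = false := arrow2_narrowhead ac arr.
have anb : anc_of C (v i.+1) by have := wv.2 i lin; rewrite /open_at col.
have [] := walk_splice wv (l := i) (r := i.+2) => //; try nat_lia.
- by rewrite adjE arrow_arrowhead.
- move=> i0; have := wv.2 i.-1; rewrite prednK // /open_at /collider ba ca andbF.
  by apply; nat_lia.
- move=> lt_in; have := wv.2 i.+1 lt_in; rewrite /open_at /collider (negbTE nbc) /= => cC.
  by case: ifP => // _; apply: anc_of_arrow arr anb.
- by move=> w [ww w0 wn]; have := vmin _ _ ww w0 wn; nat_lia.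
Qed.

Lemma vrev3 v n i : i.+1 < n ->
  [/\ vrev v n (n - i.+2) = v i.+2, vrev v n (n - i.+2).+1 = v i.+1 &
      vrev v n (n - i.+2).+2 = v i].
Proof. by move=> lin; rewrite /vrev; split; congr v; nat_lia. Qed.

(** The marks on the triple and on the shielding edge decide the side. Only an arc over a collider
    fits neither, and it gives a shorter walk. *)
Lemma minwalk_triple C v n i : minwalk C v n -> i.+1 < n ->
  (exists l, discriminated v l i (v i.+2)) \/
  (exists l, discriminated (vrev v n) l (n - i.+2) (v i)).
Proof.
move=> mv lin; have [wv vmin] := mv.
have [ac|nac] := boolP (adj G (v i) (v i.+2)); last first.
  by left; exists i; split=> // m; nat_lia.
have mv' := minwalk_rev mv; have lin' : (n - i.+2).+1 < n by nat_lia.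
have [ec eb ea] := vrev3 v lin; have := mv'.
move=> /minwalk_arrow_discriminated/(_ lin'); have := mv'.
move=> /minwalk_collider_discriminated/(_ lin'); rewrite ec eb ea => colR arrR.
have ab := wv.1 i (ltnW lin); have bc := wv.1 i.+1 lin.
have [cb|ncb] := boolP (ah (v i.+2) (v i.+1)); last first.
  have arr : arrow G (v i.+1) (v i.+2) by apply: arrow_adj.
  have [ahac|nahac] := boolP (ah (v i) (v i.+2)).
    by left; apply: (minwalk_arrow_discriminated mv).
  right; apply: arrR; last by move: ac; rewrite adjE (negbTE nahac).
  apply: arrow_adj; first by rewrite adj_sym.
  by apply: contra nahac => ahab; apply: arrowhead_arrow arr _.
have [ahab|nahab] := boolP (ah (v i) (v i.+1)); last first.
  have arr : arrow G (v i.+1) (v i) by apply: arrow_adj; rewrite // adj_sym.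
  right; apply: arrR => //; apply: arrowhead_arrow arr _ => //.
  by rewrite adj_sym.
have [nca|ca] := boolP (~~ ah (v i.+2) (v i)).
  by left; apply: (minwalk_collider_discriminated mv); rewrite /collider ?ahab //; apply: arrow_adj.
have [nahac|ahac] := boolP (~~ ah (v i) (v i.+2)).
  right; apply: colR; first by rewrite /collider cb.
  by apply: arrow_adj; rewrite // adj_sym.
(* Along the arc, an end that becomes a collider was one before or points to [v i.+1], an ancestor
   of C; any other end remains a non-collider. *)
move: ca ahac; rewrite !negbK => ca ahac; exfalso.
have anb : anc_of C (v i.+1).
  by have := wv.2 i lin; rewrite /open_at /collider ahab cb.
have [] := walk_splice wv (l := i) (r := i.+2) => //; try nat_lia.
- move=> i0; have := wv.2 i.-1; rewrite prednK // => /(_ (ltnW lin)).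
  rewrite /open_at /collider ca andbT; case: (ah (v i.-1) (v i)) => //=.
  have [//|nba _] := boolP (ah (v i.+1) (v i)).
  by apply: (anc_of_arrow _ anb); apply: arrow_adj.
- move=> lt_in; have := wv.2 i.+1 lt_in.
  rewrite /open_at /collider ahac /=; case: (ah (v i.+3) _); rewrite ?andbF ?andbT //=.
  have [//|nbc _] := boolP (ah (v i.+1) (v i.+2)).
  by apply: (anc_of_arrow _ anb); apply: arrow_adj; rewrite // adj_sym.
- by move=> w [ww w0 wn]; have := vmin _ _ ww w0 wn; nat_lia.
Qed.

(** * Maximality against inducing paths *)

Definition separable_nonadj : Prop := forall x y, x != y -> ~~ adj G x y ->
  exists C, ~ linked C C x y.

Lemma maximal_separable : maximal_graph G -> separable_nonadj.
Proof.
move=> hmax x y xy nxy; have [C [_ /separatedP sep]] := hmax x y xy nxy.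
by exists C; apply: sep; rewrite inE.
Qed.

Lemma discriminated_revE v n l i : i.+1 < n ->
  discriminated (vrev v n) l (n - i.+2) (v i) ->
  exists r, [/\ i.+1 < r <= n, ~~ adj G (v r) (v i), l = n - r &
    forall m, i < m -> m.+1 < r ->
      arrow G (v m.+1) (v i) /\ collider G (v m) (v m.+1) (v m.+2)].
Proof.
move=> lin [ln nad dis]; exists (n - l); split=> //; [nat_lia|nat_lia|].
move=> m im mr; have [] := dis (n - m.+2); first nat_lia.
have [|ec eb ea] := vrev3 v (n := n) (i := m); first nat_lia.
by rewrite ec eb ea colliderC.
Qed.

(** If each triple lies within the discriminating path of the other, the walk from [v i] to [v j.+2]
    is an inducing path: its inner nodes are colliders pointing to [v j.+2], except [v j.+1], which
    points to [v i]. *)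
Lemma discriminated_one_sided C v n l l' i j : separable_nonadj ->
  minwalk C v n -> i < j -> j.+1 < n ->
  discriminated v l j (v j.+2) -> l <= i ->
  discriminated (vrev v n) l' (n - i.+2) (v i) -> l' <= n - j.+2 -> False.
Proof.
move=> hsep mv ij jn [_ nadl disl] li; have lin : i.+1 < n by nat_lia.
case/(discriminated_revE lin) => r [/andP[ir rn] nadr -> disr] jr.
have lt_jr : j.+1 < r by nat_lia.
have [aj _] := disr j ij lt_jr.
have neq : v i != v j.+2.
  by apply/eqP; apply: (minwalk_inj mv); nat_lia.
(* If l < i then [v i -> v j.+2], and if r > j + 2 the reverse arrow exists. So one of the two paths
   has exactly these nodes as its ends, which are not adjacent. *)
have nad : ~~ adj G (v i) (v j.+2).
  have [<-//|nli] := eqVneq l i.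
  have [] := disl i.-1; first nat_lia.
  rewrite prednK; last nat_lia.
  move=> ad _; have [rE|nr] := eqVneq r j.+2; first by rewrite adj_sym -rE.
  have [||da _] := disr j.+1; [nat_lia|nat_lia|].
  by rewrite arrowE (arrow_narrowhead da) in ad.
have [C' []] := hsep _ _ neq nad; apply: (linked_inducing); exists (j.+2 - i), (fun m => v (i + m)).
split; [|by rewrite addn0|by congr v; nat_lia].
split=> m lm; rewrite !addnS; first by apply: mv.1.1; nat_lia.
have [lt_j|ge_j] := ltnP (i + m) j.
  have [|arr col] := disl (i + m); first nat_lia.
  rewrite /open_at col; apply: (anc_of_arrow arr); apply: anc_of_mem.
  by rewrite !inE eqxx orbT.
have -> : i + m = j by nat_lia.
have [arr col] := disr j ij lt_jr.
by rewrite /open_at col; apply: (anc_of_arrow arr); apply: anc_of_mem; rewrite !inE eqxx.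
Qed.

End Ancestral.
End Graph.

(** * Transport of connecting walks *)

Section Transfer.
Variable V : finType.
Implicit Types (G H : mixed_graph V) (a b d k x y : V) (C : {set V}).
Implicit Types (v w : nat -> V).

(** The case r = 0 is that of unshielded triples. *)
Definition colliders_agree G H : Prop := forall v r d,
  (forall i j, i < j <= r.+1 -> v i <> v j) ->
  (forall i, i <= r.+1 -> v i <> d) ->
  (forall i, i <= r -> adj G (v i) (v i.+1)) -> adj G (v r.+1) d ->
  discriminated G v 0 r d -> discriminated H v 0 r d ->
  collider G (v r) (v r.+1) d = collider H (v r) (v r.+1) d.

Lemma colliders_agree_sym G H : adj G =2 adj H ->
  colliders_agree G H -> colliders_agree H G.
Proof.
move=> hadj agr v r d vinj vd av ad dH dG; symmetry; apply: agr => //.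
  by move=> i ir; rewrite hadj; apply: av.
by rewrite hadj.
Qed.

Lemma discriminated_shift G v l t d : discriminated G v l t d ->
  discriminated G (fun i => v (l + i)) 0 (t - l) d.
Proof.
move=> [lt nad dis]; split; rewrite ?addn0 // => m mt.
by rewrite !addnS; apply: dis; nat_lia.
Qed.

Definition dipath G v n := forall i, i < n -> arrow G (v i) (v i.+1).

Lemma dipath_connect G v n : dipath G v n -> connect (arrow G) (v 0) (v n).
Proof.
elim: n => [|n IH] dv; first exact: connect0.
by apply: (connect_trans (IH _) (connect1 (dv n _))) => // i ?; apply: dv; nat_lia.
Qed.

(** The length of a shortest directed path into C, with an arbitrary value at nodes that are no
    ancestors of C. *)
Lemma distance_exists G C : exists dst : V -> nat, forall k, anc_of G C k ->
  (exists v, [/\ dipath G v (dst k), v 0 = k & v (dst k) \in C]) /\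
  forall n v, dipath G v n -> v 0 = k -> v n \in C -> dst k <= n.
Proof.
suff /choice[dst dstP] : forall k, exists n, anc_of G C k ->
    (exists v, [/\ dipath G v n, v 0 = k & v n \in C]) /\
    forall m v, dipath G v m -> v 0 = k -> v m \in C -> n <= m by exists dst.
move=> k; have [an_k|] := boolP (anc_of G C k); last by exists 0.
have /ex_min[n [Pn nmin]] : exists n v, [/\ dipath G v n, v 0 = k & v n \in C].
  case/existsP: an_k => c /andP[cC /connectP[p /(pathP k) kp ec]].
  exists (size p), (nth k (k :: p)); split=> //.
  by rewrite -last_nth -ec.
by exists n => _; split=> // m v dv v0 vm; apply: nmin; exists v.
Qed.

Variables (G H : mixed_graph V).
Hypotheses (hG : directed_ancestral G) (hH : directed_ancestral H).
Hypotheses (sepG : separable_nonadj G) (hadj : adj G =2 adj H).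
Hypothesis agr : colliders_agree G H.

Lemma unshielded_agree a k b : a != b -> adj G a k -> adj G k b -> ~~ adj G a b ->
  collider G a k b = collider H a k b.
Proof.
move=> /eqP ab ak kb nab.
have ne_adj x y : adj G x y -> x <> y by move=> + exy; rewrite exy adj_irr.
apply: (agr (v := vcons a (fun=> k)) (r := 0)) => //.
- by move=> [|i] [|[|j]] //=; rewrite ?andbF // => _; apply: ne_adj.
- by move=> [|[|i]] //= _; apply: ne_adj.
- by move=> [|i].
- by split; rewrite -?hadj // => m; nat_lia.
Qed.

(** The discriminating path is carried over to H from left to right. The inner node [v m.+1] is
    discriminated by the part to its left and is a non-collider towards d in G, hence in H; since
    [v m] has an arrowhead at it in H, it must point to d there. *)
Lemma discriminated_agree C v n l t d : minwalk G C v n -> t < n ->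
  v t <> d -> adj G (v t.+1) d -> discriminated G v l t d ->
  (forall m, l <= m < t -> collider H (v m) (v m.+1) (v m.+2)) ->
  collider G (v t) (v t.+1) d = collider H (v t) (v t.+1) d.
Proof.
move=> mv tn vtd ad [lt nad dis] colH; have [[av _] _] := mv.
have vd m : l <= m <= t.+1 -> v m <> d.
  have [->|ne] := eqVneq m t.+1; first by move=> _ evd; rewrite evd adj_irr in ad.
  have [->//|nt] := eqVneq m t; move=> lmt evd.
  have [] := dis m; first nat_lia.
  by move=> arr /andP[ahv _]; rewrite evd (arrow_narrowhead hG arr) in ahv.
have agr_at m : l <= m <= t -> adj G (v m.+1) d -> discriminated H v l m d ->
    collider G (v m) (v m.+1) d = collider H (v m) (v m.+1) d.
  move=> /andP[lm mt] adm dH.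
  have := agr (v := fun i => v (l + i)) (r := m - l) (d := d).
  have -> : l + (m - l).+1 = m.+1 by nat_lia.
  have -> : l + (m - l) = m by nat_lia.
  apply=> //.
  - by move=> i j ij; apply: (minwalk_inj hG mv); nat_lia.
  - by move=> i im; apply: vd; nat_lia.
  - by move=> i im; rewrite addnS; apply: av; nat_lia.
  - apply: discriminated_shift; split=> // m' lm'; apply: dis; nat_lia.
  - exact: discriminated_shift.
apply: (agr_at) => //; first by rewrite lt leqnn.
suff dH m : l <= m <= t -> discriminated H v l m d by apply: dH; rewrite lt leqnn.
elim: m => [|m IH] /andP[lm mt].
  by split; rewrite -?hadj // => m; nat_lia.
have [el|ne] := eqVneq l m.+1; first by rewrite -el; split; rewrite -?hadj // => m'; nat_lia.
have lm' : l <= m by nat_lia.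
have [] := IH; first nat_lia.
move=> _ nadH disH; have dHm : discriminated H v l m d by [].
split=> // m' /andP[lm1]; rewrite ltnS leq_eqVlt => /orP[/eqP->|lt'].
  have cH := colH m; split; last by apply: cH; nat_lia.
  have [|arr _] := dis m; first nat_lia.
  have ahd : adj G (v m.+1) d by rewrite (adjE hG) (arrow_arrowhead hG arr).
  have /andP[ahm _] : collider H (v m) (v m.+1) (v m.+2) by apply: cH; nat_lia.
  have := agr_at m _ ahd dHm.
  rewrite /collider (arrow_narrowhead hG arr) ahm andbF /= => na.
  by apply: (arrow_adj hH); [rewrite -hadj|rewrite -na //; nat_lia].
by apply: disH; rewrite lm1.
Qed.

(** A triple is bad if its status differs in H; then its discriminating path contains another bad
    triple. Bad triples discriminated from opposite sides would thus lie within each other's paths,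
    which [discriminated_one_sided] excludes. *)
Lemma minwalk_collider_eq C v n i : minwalk G C v n -> i.+1 < n ->
  collider G (v i) (v i.+1) (v i.+2) = collider H (v i) (v i.+1) (v i.+2).
Proof.
move=> mv; pose col K j := collider K (v j) (v j.+1) (v j.+2).
pose bad j := (j.+1 < n) && (col G j != col H j).
suff nbad : forall j, ~~ bad j.
  by move=> lin; have := nbad i; rewrite /bad lin negbK => /eqP.
move=> j0.
have vne j : j.+1 < n -> v j <> v j.+2 by move=> jn; apply: (minwalk_inj hG mv); nat_lia.
have badL j l : bad j -> discriminated G v l j (v j.+2) ->
    exists2 m, l <= m < j & bad m.
  move=> /andP[jn nj] dis; apply/not_exists2P => nb; case/negP: nj; apply/eqP.
  apply: (discriminated_agree mv _ _ _ dis) => //; [nat_lia|exact: vne|exact: mv.1.1|].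
  move=> m lm; have [_ _ /(_ m lm) [_]] := dis.
  have [//|nbm colG] := nb m; apply: contrapT => ncol; apply: nbm; apply/andP; split; first nat_lia.
  by rewrite /col colG; apply/eqP => e; apply: ncol; rewrite -e.
have badR j l : bad j -> discriminated G (vrev v n) l (n - j.+2) (v j) ->
    exists m, [/\ j < m, l <= n - m.+2 & bad m].
  move=> /andP[jn nj] dis; apply/not_existsP => nb; case/negP: nj; apply/eqP.
  have [ec eb ea] := vrev3 v jn.
  have := discriminated_agree (minwalk_rev hG mv) (t := n - j.+2) (d := v j) (l := l).
  rewrite ec eb /col (colliderC G) (colliderC H) => -> //.
  - nat_lia.
  - by apply/nesym/vne.
  - by rewrite adj_sym //; apply: mv.1.1; nat_lia.
  - move=> m lm; have [_ _ /(_ m lm) [_]] := dis.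
    have [|e1 e2 e3] := vrev3 v (n := n) (i := n - m.+2); first nat_lia.
    have em : n - (n - m.+2).+2 = m by nat_lia.
    move: e1 e2 e3; rewrite em => -> -> ->.
    rewrite (colliderC G) (colliderC H) => colG; apply: contrapT => ncol.
    apply: (nb (n - m.+2)); split; [nat_lia|nat_lia|apply/andP; split; first nat_lia].
    by rewrite /col colG; apply/eqP => e; apply: ncol; rewrite -e.
(* Let s be the last bad triple before j. By induction it is discriminated from the right, and the
   bad triple on its path is at j or beyond; so s and j lie within each other's paths. *)
have noL j l : bad j -> ~ discriminated G v l j (v j.+2).
  elim/ltn_ind: j l => j IH l bj dj; have [m0 /andP[lm0 m0j] bm0] := badL _ _ bj dj.
  have exs : exists s, bad s && (s < j) by exists m0; rewrite bm0.
  have ubs s : bad s && (s < j) -> s <= j by case/andP => _ /ltnW.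
  have [s /andP[bs sj] smax] := ex_maxnP exs ubs.
  have sn : s.+1 < n by case/andP: bs.
  have jn : j.+1 < n by case/andP: bj.
  have [[l' ds]|[l' ds]] := minwalk_triple hG mv sn; first exact: IH ds.
  have [m [sm lm bm]] := badR _ _ bs ds.
  have jm : j <= m.
    by rewrite leqNgt; apply/negP => mj; have := smax m; rewrite bm mj => /(_ isT); nat_lia.
  apply: (discriminated_one_sided hG sepG mv sj jn dj _ ds); last nat_lia.
  by apply: leq_trans lm0 _; apply: smax; rewrite bm0.
apply/negP => bj; have ubs s : bad s -> s <= n by case/andP => + _; nat_lia.
have [s bs smax] := ex_maxnP (ex_intro _ j0 bj) ubs.
have sn : s.+1 < n by case/andP: bs.
have [[l' ds]|[l' ds]] := minwalk_triple hG mv sn; first exact: noL ds.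
by have [m [sm _ bm]] := badR _ _ bs ds; have := smax m bm; nat_lia.
Qed.

Lemma discriminated_arrow C v n l t d : minwalk G C v n -> t.+1 < n ->
  collider G (v t) (v t.+1) (v t.+2) -> arrow G (v t.+1) d ->
  discriminated G v l t d -> arrow H (v t.+1) d.
Proof.
move=> mv tn col arr dis; have /andP[ahG _] := col.
have ad : adj G (v t.+1) d by rewrite (adjE hG) (arrow_arrowhead hG arr).
have vtd : v t <> d by move=> evd; rewrite evd (arrow_narrowhead hG arr) in ahG.
apply: (arrow_adj hH); first by rewrite -hadj.
move: col; rewrite (minwalk_collider_eq mv tn) => /andP[ahH _].
have := discriminated_agree mv (ltnW tn) vtd ad dis.
rewrite /collider (arrow_narrowhead hG arr) ahH andbF /= => <- // m lm.
have [_ _ /(_ m lm) [_]] := dis; rewrite (minwalk_collider_eq mv) //; nat_lia.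
Qed.

Lemma linked_transfer C x y : linked G C C x y -> linked H C C x y.
Proof.
move=> /(linked_minwalk) [n [v0 [mv0 v0x v0y]]].
have [dst dstP] := distance_exists G C.
(* Among the shortest walks, one with the least sum of distances to C is fixed. Its colliders are
   the same in H, and it remains to show that they are still ancestors of C. *)
have /ex_min[s [[v [mv vx vy sE]] smin]] : exists s v,
    [/\ minwalk G C v n, v 0 = x, v n = y & s = \sum_(i < n.+1) dst (v i)].
  by exists (\sum_(i < n.+1) dst (v0 i)), v0.
have [[av ov] vmin] := mv.
exists n, v; split=> //; split=> i lin; first by rewrite -hadj; apply: av.
have := ov i lin; rewrite /open_at -(minwalk_collider_eq mv lin).
case: ifP => // col an_b; have [[u [du u0 uC]] umin] := dstP _ an_b.
have [m0|m_gt0] := posnP (dst (v i.+1)).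
  by apply: anc_of_mem; rewrite -u0 -m0.
set m := dst (v i.+1) in du uC umin m_gt0.
have arr0 : arrow G (v i.+1) (u 1) by rewrite -u0; apply: du.
have du1 : dipath G (fun j => u j.+1) m.-1 by move=> j jm; apply: du; nat_lia.
have an_d : anc_of G C (u 1).
  apply: anc_of_connect (dipath_connect du1) _.
  by apply: anc_of_mem; rewrite prednK.
have lt_d : dst (u 1) < m.
  have [_ dmin] := dstP _ an_d.
  by have := dmin _ _ du1 erefl; rewrite prednK // => /(_ uC); nat_lia.
suff arrH : arrow H (u 0) (u 1).
  (* Once the first arrow is kept, the others follow in turn: as u is shortest, two consecutive
     arrows form an unshielded triple, whose middle node is a non-collider in H too. *)
  suff dH j : j < m -> arrow H (u j) (u j.+1).
    rewrite -u0; apply: anc_of_connect (dipath_connect dH) _; exact: anc_of_mem.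
  elim: j => // j IH jm; have a1 := du j (ltnW jm); have a2 := du j.+1 jm.
  have ne : u j != u j.+2.
    by apply/eqP => e; have := arrow_narrowhead hG a2; rewrite -e (arrow_arrowhead hG a1).
  have nad : ~~ adj G (u j) (u j.+2).
    apply/negP => ad; have a3 : arrow G (u j) (u j.+2).
      by apply: (arrow_adj hG) => //; rewrite (arrow2_narrowhead hG a1 a2).
    have := umin m.-1 (fun i => if i <= j then u i else u i.+1).
    rewrite /= ifN; last by nat_lia.
    rewrite prednK // => /(_ _ u0 uC); suff : dipath G (fun i => if i <= j then u i else u i.+1) m.-1.
      by move=> h /(_ h); nat_lia.
    move=> k km; have [lt_kj|lt_jk|->//] := ltngtP k j.
      by apply: du; nat_lia.
    by apply: du; nat_lia.
  have ad1 : adj G (u j) (u j.+1) by rewrite (adjE hG) (arrow_arrowhead hG a1).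
  have ad2 : adj G (u j.+1) (u j.+2) by rewrite (adjE hG) (arrow_arrowhead hG a2).
  have := unshielded_agree ne ad1 ad2 nad.
  rewrite /collider (arrow_narrowhead hG a2) andbF.
  rewrite (arrow_arrowhead hH (IH (ltnW jm))) /= => na.
  by apply: (arrow_adj hH); [rewrite -hadj|rewrite -na].
rewrite u0; have /andP[ab cb] := col.
(* To be used for v and for its reversal: either the first arrow is kept in H, or a node on that
   side of [v i.+1] can be joined to [u 1]. *)
have short w (k : nat) : minwalk G C w n -> k.+1 < n -> w k.+1 = v i.+1 ->
    collider G (w k) (w k.+1) (w k.+2) ->
    arrow H (v i.+1) (u 1) \/ exists l, [/\ l <= k, arrowhead_at G (w l) (u 1) &
      0 < l -> open_at G C C (w l.-1) (w l) (u 1)].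
  move=> mw kn wk colw; have arrw : arrow G (w k.+1) (u 1) by rewrite wk.
  have /andP[ahw _] := colw.
  have [| | |[l dis]|] := discriminated_or_shortcut hG mw.1 (t := k) (d := u 1) _ _ _.
  - nat_lia.
  - exact: arrowhead_arrow ahw arrw.
  - move=> k0 pk dk; have := mw.1.2 k.-1; rewrite prednK // /open_at => /(_ (ltnW kn)).
    suff -> : collider G (w k.-1) (w k) (w k.+1) by [].
    rewrite /collider pk; apply: contraTT dk => h3; rewrite (arrow2_narrowhead hG _ arrw) //.
    by rewrite (arrowE hG) ahw.
  - by left; rewrite -wk; apply: discriminated_arrow mw kn colw arrw dis.
  - by right.
have [//|[l [li ahl opl]]] := short v i mv lin erefl col.
have lin' : (n - i.+2).+1 < n by nat_lia.
have [ec eb ea] := vrev3 v lin.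
have := short _ _ (minwalk_rev hG mv) lin' eb; rewrite ec eb ea colliderC => /(_ col).
case=> // [[l' [li' ahr opr]]].
(* Joined from both sides, [u 1] becomes a collider that is an ancestor of C. *)
have [] := walk_insert mv.1 (l := l) (r := n - l') (d := u 1); try nat_lia.
- by rewrite (adjE hG) ahl.
- by rewrite (adjE hG) ahr orbT.
- by rewrite /open_at /collider ahl ahr.
- exact: opl.
- move=> lt_n; have l'0 : 0 < l' by nat_lia.
  rewrite open_atC; have := opr l'0; rewrite /vrev.
  by have -> : n - l'.-1 = (n - l').+1 by nat_lia.
move=> w [ww w0 wn wE]; have ge_n := vmin _ _ ww w0 wn.
(* The new walk has l + l' + 2 edges, so by minimality it only replaces [v i.+1] by [u 1], which is
   nearer to C; the sum of distances would drop. *)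
have [el el'] : l = i /\ n - l' = i.+2 by nat_lia.
subst l; have en : i + (n - (n - l')).+2 = n by nat_lia.
rewrite en in ww wn; have {}wE := wE el'.
suff : s <= \sum_(j < n.+1) dst (w j).
  have lt_i : i.+1 < n.+1 by nat_lia.
  rewrite sE (bigD1 (Ordinal lt_i)) //= [X in _ <= X](bigD1 (Ordinal lt_i)) //=.
  rewrite wE eqxx (eq_bigr (fun j : 'I_n.+1 => dst (w j))) ?leq_add2r; first by rewrite -/m; nat_lia.
  by move=> j; rewrite -val_eqE /= wE => /negbTE ->.
apply: smin; exists w; rewrite w0 wn; split=> //; split=> // m' w' ww' w'0 w'n.
by apply: (vmin _ w') => //; rewrite -?w0 -?wn.
Qed.

End Transfer.

(** * Criterion for Markov equivalence *)

Lemma markov_equivalent_of_colliders (V : finType) (G H : mixed_graph V) :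
  directed_ancestral G -> directed_ancestral H ->
  maximal_graph G -> maximal_graph H -> adj G =2 adj H ->
  colliders_agree G H -> markov_equivalent G H.
Proof.
move=> hG hH /(maximal_separable hG) sG /(maximal_separable hH) sH hadj agr.
have hadj' : adj H =2 adj G by move=> x y; rewrite hadj.
have agr' := colliders_agree_sym hadj agr.
apply/predeqP => -[[A B] C]; rewrite /indep_model; split=> -[disj /separatedP sep]; split=> //;
  apply/separatedP => // x y xA yB.
- by move/(linked_transfer hH hG sH hadj' agr'); apply: sep.
- by move/(linked_transfer hG hH sG hadj agr); apply: sep.
Qed.

(** * Ordered stability *)

Section Stability.
Variables (V : finType) (I : {set V} -> {set V} -> {set V} -> Prop).
Implicit Types (G H : mixed_graph V) (i j k x y : V) (C D : {set V}).

(** By acyclicity; hence the number of ancestors strictly increases along arrows. *)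
Lemma an_proper G k l : directed_ancestral G -> k \in an G l ->
  an G k \proper an G l.
Proof.
move=> hG; rewrite inE => /andP[kl ckl]; apply/fintype.properP; split.
  apply/fintype.subsetP => m; rewrite !inE => /andP[mk cmk].
  rewrite (connect_trans cmk ckl) andbT; apply: contraNneq mk => eml; subst m.
  case/connectP: ckl cmk => -[|z p] /= pkl el; first by rewrite el eqxx in kl.
  case/andP: pkl => kz zp; subst l => clk.
  have := arrowhead_nanc hG (arrow_arrowhead hG kz).
  by rewrite (connect_trans _ clk) //; apply/connectP; exists p.
by exists k; rewrite inE ?kl ?eqxx.
Qed.

Lemma an2_sub G i j : an2 G i j \subset ~: [set i; j].
Proof. by rewrite /an2 finset.setDE finset.subsetIr. Qed.

(** Nodes of an(i,j) are above i or j in the minimal order, so upward stability adds them one at a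
    time. *)
Lemma stable_add_ancestors G i j C D : ordered_upward_stable I (minimal_lt G) ->
  i != j -> C \subset ~: [set i; j] -> D \subset an2 G i j ->
  I [set i] [set j] C -> I [set i] [set j] (C :|: D).
Proof.
move=> hup ij Cij; elim: {D}_.+1 {-2}D (ltnSn #|D|) => // n IH D; rewrite ltnS => Dn Dan IC.
have [->|[k kD]] := set_0Vmem D; first by rewrite finset.setU0.
have Dan' : D :\ k \subset an2 G i j by apply: fintype.subset_trans Dan; exact: finset.subsetDl.
have /= := hup i j (C :|: D :\ k) ij _ _ k.
have -> : k |: (C :|: D :\ k) = C :|: D.
  by rewrite finset.setUCA finset.setD1K.
have := fintype.subsetP Dan k kD; rewrite /an2 finset.in_setD => /andP[kij kan]; apply.
- rewrite finset.subUset Cij /=; apply: fintype.subset_trans Dan' (an2_sub _ _ _).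
- by apply: IH => //; move: Dn; rewrite (cardsD1 k) kD.
- by [].
- by rewrite /minimal_lt; move: kan; rewrite inE.
Qed.

Lemma stable_remove_sink G i j k C : directed_ancestral G ->
  ordered_downward_stable I (minimal_lt G) ->
  i != j -> C \subset ~: [set i; j] -> an2 G i j \subset C ->
  k \in C :\: an2 G i j -> I [set i] [set j] C ->
  exists2 m, m \in C :\: an2 G i j & I [set i] [set j] (C :\ m).
Proof.
move=> hG hdown ij Cij anC kC IC.
(* Among the nodes of C outside an(i,j), m has the most ancestors. A node of C below m would have
   more, and it too is outside an(i,j), since otherwise m would be inside. *)
case: (arg_maxnP (fun m => #|an G m|) kC) => m mC mmax; exists m => //.
have : m \in C :\: an2 G i j := mC; rewrite finset.in_setD => /andP[nm mC'].
have mij : m \notin [set i; j] by have := fintype.subsetP Cij m mC'; rewrite finset.inE.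
have nan : m \notin an G i :|: an G j.
  by apply: contra nm => h; rewrite /an2 finset.inE mij.
apply: hdown => //; [move: nan|move: nan|]; rewrite /minimal_lt ?finset.in_setU ?negb_or.
- by case/andP.
- by case/andP.
- move=> l; rewrite finset.in_setD1 => /andP[lm lC]; apply/negP => mal.
  suff lmax : l \in C :\: an2 G i j.
    by have : #|an G l| <= #|an G m| := mmax l lmax; rewrite leqNgt (proper_card (an_proper hG mal)).
  rewrite finset.in_setD lC andbT; apply: contra nm; rewrite /an2 !finset.in_setD mij /=.
  by case/andP=> _; rewrite !finset.in_setU => /orP[]
    /(an_proper hG)/fintype.proper_sub/fintype.subsetP/(_ _ mal) ->; rewrite ?orbT.
Qed.

(** Nodes are removed one at a time until it is the turn of k; D is what is left then, so that the
    two conditioning sets differ in k alone. *)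
Lemma stable_remove_nonancestor G i j k C : directed_ancestral G ->
  ordered_downward_stable I (minimal_lt G) ->
  i != j -> C \subset ~: [set i; j] -> an2 G i j \subset C ->
  k \in C :\: an2 G i j -> I [set i] [set j] C ->
  exists D, [/\ D \subset ~: [set i; j], an2 G i j \subset D, k \notin D,
    I [set i] [set j] D & I [set i] [set j] (k |: D)].
Proof.
move=> hG hdown ij; elim: {C}_.+1 {-2}C (ltnSn #|C|) => // n IH C.
rewrite ltnS => Cn Cij anC kC IC.
have [m mC Im] := stable_remove_sink hG hdown ij Cij anC kC IC.
have /finset.setDP[mC' nm] := mC; have /finset.setDP[kC' nk] := kC.
have Cij' : C :\ m \subset ~: [set i; j].
  by apply: fintype.subset_trans Cij; exact: finset.subsetDl.
have anC' : an2 G i j \subset C :\ m by rewrite finset.subsetD1 anC nm.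
have [ekm|nkm] := eqVneq k m.
  by exists (C :\ m); split=> //; rewrite ekm ?finset.setD1K // !inE eqxx.
apply: (IH (C :\ m)) => //; last first.
  by apply/finset.setDP; split=> //; apply/finset.setD1P.
by move: Cn; rewrite (cardsD1 m) mC'.
Qed.

Lemma stable_remove_nonancestors G i j C : directed_ancestral G ->
  ordered_downward_stable I (minimal_lt G) ->
  i != j -> C \subset ~: [set i; j] -> an2 G i j \subset C ->
  I [set i] [set j] C -> I [set i] [set j] (an2 G i j).
Proof.
move=> hG hdown ij; elim: {C}_.+1 {-2}C (ltnSn #|C|) => // n IH C.
rewrite ltnS => Cn Cij anC IC; have [e|[k kC]] := set_0Vmem (C :\: an2 G i j).
  suff <- : C = an2 G i j by [].
  by apply/eqP; rewrite finset.eqEsubset anC -finset.setD_eq0 e eqxx.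
have [m mC Im] := stable_remove_sink hG hdown ij Cij anC kC IC.
have /finset.setDP[mC' nm] := mC.
apply: (IH (C :\ m)) => //; rewrite ?finset.subsetD1 ?anC ?nm //.
- by move: Cn; rewrite (cardsD1 m) mC'.
- by apply: fintype.subset_trans Cij; exact: finset.subsetDl.
Qed.

Lemma nskP i j : i != j -> ~~ sk I i j ->
  exists C, C \subset ~: [set i; j] /\ I [set i] [set j] C.
Proof. by move=> ij; rewrite /sk ij /= => /asboolPn/contrapT. Qed.

(** Maximality and the Markov property give an independence for each non-adjacent pair. Conversely,
    an independence given any C moves to an(i,j) by adding the ancestors and removing the rest,
    where the converse pairwise Markov property applies. *)
Lemma adj_sk G : directed_ancestral G -> maximal_graph G -> markovian I G ->
  converse_pairwise_markovian I G ->
  ordered_upward_stable I (minimal_lt G) ->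
  ordered_downward_stable I (minimal_lt G) -> adj G =2 sk I.
Proof.
move=> hG hmax hmark hconv hup hdown i j.
have [->|ij] := eqVneq i j; first by rewrite adj_irr // /sk eqxx.
apply/idP/idP => [ad|]; last first.
  apply: contraLR => /(hmax _ _ ij)[C [Cij sep]]; rewrite /sk ij /=.
  apply/asboolPn => nex; apply: nex; exists C; split=> //; apply: hmark => //.
  move: Cij; rewrite finset.subsetC finset.subUset !finset.sub1set !finset.in_setC => /andP[iC jC].
  by rewrite /disjoint3 !disjoints1 inE ij iC.
rewrite /sk ij /=; apply/asboolP => -[C [Cij IC]].
have := hconv i j ij; rewrite ad => /(_ _)/negP; apply => //.
have Can := stable_add_ancestors hup ij Cij (fintype.subxx _) IC.
apply: (stable_remove_nonancestors hG hdown ij _ _ Can).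
  by rewrite finset.subUset Cij an2_sub.
exact: finset.subsetUr.
Qed.

(** * Disagreement on colliders and instability *)

(* Stability with respect to H brings k into the conditioning set, and
   stability with respect to G takes it out again. *)
Lemma collider_disagreement G H (v : nat -> V) r d :
  directed_ancestral G -> directed_ancestral H -> separable_nonadj G ->
  adj G =2 sk I ->
  ordered_upward_stable I (minimal_lt G) ->
  ordered_downward_stable I (minimal_lt G) ->
  ordered_upward_stable I (minimal_lt H) -> adj H =2 sk I ->
  (forall m m', m < m' <= r.+1 -> v m <> v m') ->
  (forall m, m <= r.+1 -> v m <> d) ->
  (forall m, m <= r -> adj G (v m) (v m.+1)) -> adj G (v r.+1) d ->
  discriminated G v 0 r d -> discriminated H v 0 r d ->
  collider G (v r) (v r.+1) d -> ~~ collider H (v r) (v r.+1) d ->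
  exists D, [/\ D \subset ~: [set v 0; d],
    forall m, m < r -> v m.+1 \in D, v r.+1 \notin D,
    I [set v 0] [set d] D & I [set v 0] [set d] (v r.+1 |: D)].
Proof.
move=> hG hH sepG skG upG downG upH skH vinj vd av ad disG disH colG ncolH.
have ij : v 0 != d by apply/eqP/vd.
have [_ nad dG] := disG; have [_ _ dH] := disH.
have [C [Cij IC]] : exists C, C \subset ~: [set v 0; d] /\ I [set v 0] [set d] C.
  by apply: nskP; rewrite -?skG.
have in_an2 K m : 0 < m <= r.+1 ->
    (m.-1 < r -> arrow K (v m) d) ->
    (r <= m.-1 -> connect (arrow K) (v m) (v 0) || connect (arrow K) (v m) d) ->
    v m \in an2 K (v 0) d.
  move=> /andP[m0 mr] a1 a2; have n0 : v m != v 0 by apply/eqP/nesym/vinj; rewrite m0.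
  have nd : v m != d by apply/eqP/vd.
  rewrite /an2 !inE (negbTE n0) (negbTE nd) /=.
  by have [/a1/connect1->|/a2] := ltnP m.-1 r; rewrite ?orbT.
(* A non-collider k in H points to d, or to [v r], which is [v 0] or points to d. *)
have kH : v r.+1 \in an2 H (v 0) d.
  apply: in_an2; rewrite ?leqnn //= ?ltnn // => _.
  move: ncolH; rewrite /collider negb_and => /orP[na|na]; last first.
    by apply/orP; right; apply/connect1/(arrow_adj hH); rewrite // skH -skG.
  have arr : arrow H (v r.+1) (v r).
    by apply: (arrow_adj hH) => //; rewrite skH -skG adj_sym //; apply: av.
  move: arr dH; clear; case: r => [|r] arr dH.
    by rewrite connect1.
  have [|arr' _] := dH r; first by rewrite leqnn.
  by rewrite (connect_trans (connect1 arr) (connect1 arr')) orbT.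
(* A collider k that is an ancestor of [v 0] or d would complete an inducing path between them in
   G. *)
have nkG : v r.+1 \notin an2 G (v 0) d.
  apply/negP => kG; have [C' []] := sepG _ _ ij nad.
  apply: (linked_inducing hG).
  exists (r.+1 + 1), (vcat v r.+1 (fun=> d)); split=> //; last first.
    by rewrite /vcat ifN //; nat_lia.
  apply: walk_cat => //; last first.
    move=> _; rewrite /open_at colG.
    move: kG; rewrite /an2 !inE => /andP[_ /orP[]/andP[_ conn]];
      apply: (anc_of_connect conn); apply: anc_of_mem; by rewrite !inE eqxx ?orbT.
  split=> m mr; first exact: av.
  have [|arr col] := dG m; first by [].
  rewrite /open_at col; apply: (anc_of_arrow arr); apply: anc_of_mem.
  by rewrite !inE eqxx orbT.
have UH m : m < r -> v m.+1 \in an2 H (v 0) d.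
  move=> mr; apply: in_an2; [nat_lia|by move=> _; have [] := dH m|move=> /=; nat_lia].
have UG m : m < r -> v m.+1 \in an2 G (v 0) d.
  move=> mr; apply: in_an2; [nat_lia|by move=> _; have [] := dG m|move=> /=; nat_lia].
(* The ancestors in H bring in k; those in G are added next, since the removal with respect to G
   starts from a set containing them. *)
have IC1 := stable_add_ancestors upH ij Cij (fintype.subxx _) IC.
have C1ij : C :|: an2 H (v 0) d \subset ~: [set v 0; d].
  by rewrite finset.subUset Cij an2_sub.
have IC2 := stable_add_ancestors upG ij C1ij (fintype.subxx _) IC1.
have [] := stable_remove_nonancestor (k := v r.+1) hG downG ij _ _ _ IC2.
- by rewrite finset.subUset C1ij an2_sub.
- exact: finset.subsetUr.
- apply/finset.setDP; split=> //; apply/finset.setUP; left.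
  by apply/finset.setUP; right.
move=> D [Dij anD kD ID IkD]; exists D; split=> // m mr.
exact: (fintype.subsetP anD _ (UG m mr)).
Qed.

(** The path is v 0, ..., v r.+1, d; U consists of v 1, ..., v r, which all lie in D, and the set C
    of the definition is D without U. *)
Lemma collider_disagreement_path_unstable G (v : nat -> V) r d D :
  directed_ancestral G -> adj G =2 sk I ->
  (forall m m', m < m' <= r.+1 -> v m <> v m') ->
  (forall m, m <= r.+1 -> v m <> d) ->
  (forall m, m <= r -> adj G (v m) (v m.+1)) -> adj G (v r.+1) d ->
  discriminated G v 0 r d -> D \subset ~: [set v 0; d] ->
  (forall m, m < r -> v m.+1 \in D) -> v r.+1 \notin D ->
  I [set v 0] [set d] D -> I [set v 0] [set d] (v r.+1 |: D) ->
  path_unstable I.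
Proof.
move=> hG skG vinj vd av ad [_ nad dG] Dij UD kD ID IkD.
pose p := mkseq (fun m => v m.+1) r.
have pE : p ++ [:: v r.+1; d] = rcons (mkseq (fun m => v m.+1) r.+1) d.
  by rewrite -cat_rcons cats1 /p -mkseqS.
have vE : v 0 :: mkseq (fun m => v m.+1) r.+1 = mkseq v r.+2.
  by rewrite /mkseq /= (iotaDl 1 1) -map_comp.
have pD x : x \in p -> x \in D.
  by case/mapP => m; rewrite mem_iota /= => mr ->; apply: UD.
exists (v 0), p, (v r.+1), d, (D :\: [set x in p]); split.
- rewrite pE; split.
    rewrite rcons_path; apply/andP; split.
      apply/(pathP (v 0)) => m; rewrite size_mkseq => mr.
      rewrite vE nth_mkseq; last exact: ltnW.
      by rewrite nth_mkseq // -skG; apply: av.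
    by rewrite (last_nth (v 0)) vE size_mkseq nth_mkseq // -skG.
  rewrite -rcons_cons vE rcons_uniq; apply/andP; split.
    by apply/negP => /mapP[m]; rewrite mem_iota /= => mr /esym; apply: vd.
  apply/(uniqP (v 0)) => m m'; rewrite !inE size_mkseq => lm lm'; rewrite !nth_mkseq //.
  by move=> e; have [lt|lt|//] := ltngtP m m';
    [case: (vinj m m' _ e)|case: (vinj m' m _ (esym e))]; rewrite lt.
- by rewrite -skG.
- move=> x /mapP[m]; rewrite mem_iota /= => mr ->; rewrite -skG.
  by have [|arr _] := dG m; rewrite // (adjE hG) (arrow_arrowhead hG arr).
- rewrite finset.disjoints_subset; apply/fintype.subsetP => x /finset.setDP[xD _].
  have := fintype.subsetP Dij x xD; rewrite !inE => /norP[n1 n2].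
  rewrite !negb_or n1 n2 /=.
  by apply: contraNneq kD => <-.
- have -> : [set x in p] :|: D :\: [set x in p] = D.
    apply/finset.setP => x; rewrite !inE; case: (boolP (x \in p)) => //= /pD ->; done.
  by rewrite finset.setUC.
Qed.

Lemma path_stable_colliders_agree G H :
  directed_ancestral G -> directed_ancestral H ->
  maximal_graph G -> maximal_graph H ->
  adj G =2 sk I -> adj H =2 sk I ->
  ordered_upward_stable I (minimal_lt G) ->
  ordered_downward_stable I (minimal_lt G) ->
  ordered_upward_stable I (minimal_lt H) ->
  ordered_downward_stable I (minimal_lt H) ->
  path_stable I -> colliders_agree G H.
Proof.
move=> hG hH /(maximal_separable hG) sepG /(maximal_separable hH) sepH skG skH.
move=> upG downG upH downH stable v r d vinj vd av ad disG disH.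
have unstable D : D \subset ~: [set v 0; d] -> (forall m, m < r -> v m.+1 \in D) ->
    v r.+1 \notin D -> I [set v 0] [set d] D ->
    I [set v 0] [set d] (v r.+1 |: D) -> False.
  move=> Dij UD kD ID IkD; apply: stable.
  exact: (collider_disagreement_path_unstable hG skG vinj vd av ad disG Dij UD kD ID IkD).
case colG: (collider G _ _ _); case colH: (collider H _ _ _) => //; exfalso.
- have [D []] := collider_disagreement hG hH sepG skG upG downG upH skH
    vinj vd av ad disG disH colG (negbT colH).
  exact: unstable.
- have avH m : m <= r -> adj H (v m) (v m.+1) by rewrite skH -skG; apply: av.
  have adH : adj H (v r.+1) d by rewrite skH -skG.
  have [D []] := collider_disagreement hH hG sepH skH upH downH upG skG
    vinj vd avH adH disH disG colH (negbT colG).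
  exact: unstable.
Qed.

(* In a DAG the last inner node of a discriminating path for k cannot be a
   collider next to a collider k, so only unshielded triples matter. *)
Lemma V_stable_colliders_agree G H : is_dag G -> is_dag H ->
  maximal_graph G -> maximal_graph H ->
  adj G =2 sk I -> adj H =2 sk I ->
  ordered_upward_stable I (minimal_lt G) ->
  ordered_downward_stable I (minimal_lt G) ->
  ordered_upward_stable I (minimal_lt H) ->
  ordered_downward_stable I (minimal_lt H) ->
  V_stable I -> colliders_agree G H.
Proof.
move=> [hG nbG] [hH nbH] /(maximal_separable hG) sepG /(maximal_separable hH) sepH.
move=> skG skH upG downG upH downH stable v r d vinj vd av ad disG disH.
have dag_ncol K : directed_ancestral K -> (forall x y, ~~ bidir K x y) ->
    0 < r -> discriminated K v 0 r d -> collider K (v r) (v r.+1) d = false.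
  move=> hK nbK r0 [_ _ dK]; have [|_ /andP[_]] := dK r.-1; first by rewrite prednK /=.
  rewrite prednK // /arrowhead_at (negbTE (nbK _ _)) orbF => arr.
  by rewrite /collider (arrow_narrowhead hK arr).
have [r0|r0] := posnP r; last by rewrite !dag_ncol.
subst r; have [_ nad _] := disG.
have unstable D : D \subset ~: [set v 0; d] -> v 1 \notin D ->
    I [set v 0] [set d] D -> I [set v 0] [set d] (v 1 |: D) -> False.
  move=> Dij kD ID IkD; apply: stable; exists (v 0), (v 1), d, D; split=> //.
  - exact/eqP/vd.
  - by split; rewrite -skG //; apply: av.
  - rewrite finset.disjoints_subset; apply/fintype.subsetP => x xD.
    have := fintype.subsetP Dij x xD; rewrite !inE => /norP[n1 n2].
    rewrite !negb_or n1 n2 /=.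
    by apply: contraNneq kD => <-.
  - by rewrite finset.setUC.
case colG: (collider G _ _ _); case colH: (collider H _ _ _) => //; exfalso.
- have [D [Dij _]] := collider_disagreement hG hH sepG skG upG downG upH skH
    vinj vd av ad disG disH colG (negbT colH).
  exact: unstable.
- have avH m : m <= 0 -> adj H (v m) (v m.+1) by rewrite skH -skG; apply: av.
  have adH : adj H (v 1) d by rewrite skH -skG.
  have [D [Dij _]] := collider_disagreement hH hG sepH skH upH downH upG skG
    vinj vd avH adH disH disG colH (negbT colG).
  exact: unstable.
Qed.

End Stability.

Theorem theorem25 (R : realType) (d : measure_display) (T : measurableType d)
    (P : probability T R) (V : finType) (dE : V -> measure_display)
    (E : forall v : V, measurableType (dE v)) (X : forall v : V, {mfun T >-> E v})
    (G0 GP : mixed_graph V)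
    (hG0 : directed_ancestral G0) (hmax : maximal_graph G0)
    (hmarkov : markovian (cond_indep P X) G0)
    (hconv : converse_pairwise_markovian (cond_indep P X) G0)
    (hup : ordered_upward_stable (cond_indep P X) (minimal_lt G0))
    (hdown : ordered_downward_stable (cond_indep P X) (minimal_lt G0))
    (hGP : natural_output (cond_indep P X) GP) :
  (path_stable (cond_indep P X) -> markov_equivalent GP G0) /\
  (is_dag G0 -> V_stable (cond_indep P X) -> is_dag GP ->
     markov_equivalent GP G0).
Proof.
have skG0 := adj_sk hG0 hmax hmarkov hconv hup hdown.
have [hG maxG skG upG downG] := hGP.
have hadj : adj GP =2 adj G0 by move=> x y; rewrite skG skG0.
split=> [stable|dag0 stable dagG]; apply: markov_equivalent_of_colliders => //.
- exact: path_stable_colliders_agree stable.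
- exact: V_stable_colliders_agree stable.
Qed.
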